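(* Let $k$ be a positive integer, and define the sequence $(u_n)_{n\ge 0}$ by \[ u_0=k,\qquad u_1=k(32k^2-4k-1),\qquad u_{n+2}=(64k^2-2)u_{n+1}-u_n\quad(n\ge 0). \] Then, for every $n\ge 2$, the set \[ \left\{T_{16k^2-1},\;T_{\frac{u_n-4k^2-k}{2k}},\;T_{\frac{u_n+4k^2-k}{2k}},\;T_{\frac{u_n^2}{k^2}-1}\right\} \] is a $D(u_n^2)$-quadruple consisting of four distinct positive triangular numbers.
   Context: For a positive integer $m$, $T_m=m(m+1)/2$ denotes the $m$-th triangular number (in particular, all indices displayed in the claim are asserted to be positive integers). For a nonzero integer $N$, a $D(N)$-$m$-tuple is a set of $m$ distinct positive integers such that the product of any two distinct elements, increased by $N$, is a perfect square; for $m=4$ it is called a $D(N)$-quadruple. *)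

(* Defs.v *)
From HB Require Import structures.
From mathcomp Require Import all_boot all_order all_algebra finmap.
Set Implicit Arguments.
Unset Strict Implicit.
Unset Printing Implicit Defensive.
Import Order.TTheory GRing.Theory Num.Theory.
Local Open Scope ring_scope.

Definition triangular (m : nat) : nat := ((m * m.+1) %/ 2)%N.

Definition is_Dtuple (N : int) (m : nat) (A : {fset nat}) : Prop :=
  [/\ N != 0,
      #|` A| = m,
      forall x : nat, x \in A -> (0 < x)%N
    & forall x y : nat, x \in A -> y \in A -> x != y ->
        exists z : int, x%:Z * y%:Z + N = z ^+ 2].

Definition is_Dquadruple (N : int) (A : {fset nat}) : Prop := is_Dtuple N 4 A.

Fixpoint u (k : int) (n : nat) : int :=
  match n with
  | 0 => k
  | n1.+1 =>
    match n1 with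
    | 0 => k * (32 * k ^+ 2 - 4 * k - 1)
    | n0.+1 => (64 * k ^+ 2 - 2) * u k n1 - u k n0
    end
  end.

(* Main.v *)
Require Import Defs.
From HB Require Import structures.
From mathcomp Require Import all_boot all_order all_algebra finmap.
From mathcomp Require Import zify ring lra.
Set Implicit Arguments.
Unset Strict Implicit.
Unset Printing Implicit Defensive.
Import Order.TTheory GRing.Theory Num.Theory.
Local Open Scope ring_scope.

(** Put [v = u_n / k] and [A = 16 k^2]. Then [v] is an odd integer, and the
    triangular numbers are [A (A - 1) / 2], [((v - 4k)^2 - 1) / 8],
    [((v + 4k)^2 - 1) / 8] and [v^2 (v^2 - 1) / 2]. Except for the first times
    the last, each product plus [k^2 v^2] is identically a square (integral
    since [v] is odd); for that one it is [k^2 v^2 (4 (A - 1) (v^2 - 1) + 1)],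
    whose last factor is a square because [v] solves a Pell-type equation
    preserved by the recurrence. *)

Lemma triangular_double (m : nat) :
  2 * (triangular m)%:Z = m%:Z * (m%:Z + 1).
Proof.
have even_mm1 : (2 %| m * m.+1)%N by rewrite dvdn2 oddM oddS andbN.
have := divnK even_mm1; rewrite -/(triangular m); lia.
Qed.

Lemma triangular_lt (m n : nat) : (m < n)%N -> (triangular m < triangular n)%N.
Proof.
move=> lt_mn; have := triangular_double m; have := triangular_double n; nia.
Qed.

(** The constant 27 is the value of [32 * k ^+ 2 - 4 * k - 1] at [k = 1]; monotonicity carries the
    bound along. *)
Lemma u_growth (k : int) (n : nat) : 0 < k ->
  [/\ k <= u k n, u k n <= u k n.+1 & 27 * k <= u k n.+1].
Proof.
move=> k_gt0; elim: n => [|n [IH1 IH2 IH3]].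
  have -> : u k 1 = k * (32 * k ^+ 2 - 4 * k - 1) by [].
  by have -> : u k 0 = k by []; split; nia.
have -> : u k n.+2 = (64 * k ^+ 2 - 2) * u k n.+1 - u k n by [].
have k2 : 1 <= k ^+ 2 by nia.
by split; nia.
Qed.

(** With [u k n = k * (2 * t + 1)] this bound amounts to [16 * k ^+ 2 - 1 < t - 2 * k], that is,
    first index < second index. *)
Lemma u_gt (k : int) (n : nat) : 0 < k -> (2 <= n)%N ->
  k * (32 * k ^+ 2 + 4 * k - 1) < u k n.
Proof.
case: n => [|[|n]] // k_gt0 _.
have [_ le_u ge_u] := u_growth n k_gt0.
have -> : u k n.+2 = (64 * k ^+ 2 - 2) * u k n.+1 - u k n by [].
have k2 : k <= k ^+ 2 by nia.
have : (64 * k ^+ 2 - 3) * (27 * k) <= (64 * k ^+ 2 - 3) * u k n.+1.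
  by apply: ler_wpM2l => //; lia.
nia.
Qed.

(* Here [u_n / k = 2 t + 1]. One step of the recurrence multiplies
   [s + 2 (u_n / k) sqrt (16 k^2 - 1)] by the norm-one element
   [32 k^2 - 1 + 8 k sqrt (16 k^2 - 1)], so the norm in the last equation is
   preserved. *)
Lemma u_pell (k : int) (n : nat) :
  exists t s : int,
    [/\ u k n = k * (2 * t + 1),
        u k n.+1 = k * ((32 * k ^+ 2 - 1) * (2 * t + 1) + 4 * k * s)
      & s ^+ 2 = 4 * (16 * k ^+ 2 - 1) * ((2 * t + 1) ^+ 2 - 1) + 1].
Proof.
elim: n => [|n [t [s [un un1 pell]]]].
  (* The sign of [s = -1] is forced by the term [- 4 * k] in [u k 1]. *)
  by exists 0, (-1); split=> /=; ring.
exists (16 * k ^+ 2 * (2 * t + 1) - t - 1 + 2 * k * s),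
       ((32 * k ^+ 2 - 1) * s + 16 * k * (16 * k ^+ 2 - 1) * (2 * t + 1)).
split; first by rewrite un1; ring.
- have -> : u k n.+2 = (64 * k ^+ 2 - 2) * u k n.+1 - u k n by [].
  by rewrite un un1; ring.
- by lra.
Qed.

Lemma Dquadruple_of_sorted (N : int) (x y z w : nat) :
  N != 0 -> (0 < x)%N -> (x < y)%N -> (y < z)%N -> (z < w)%N ->
  (exists r : int, x%:Z * y%:Z + N = r ^+ 2) ->
  (exists r : int, x%:Z * z%:Z + N = r ^+ 2) ->
  (exists r : int, x%:Z * w%:Z + N = r ^+ 2) ->
  (exists r : int, y%:Z * z%:Z + N = r ^+ 2) ->
  (exists r : int, y%:Z * w%:Z + N = r ^+ 2) ->
  (exists r : int, z%:Z * w%:Z + N = r ^+ 2) ->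
  is_Dquadruple N [fset x; y; z; w]%fset.
Proof.
move=> N0 x0 xy yz zw exy exz exw eyz eyw ezw; split=> //.
- by rewrite fsetUC cardfsU1 fsetUC cardfsU1 cardfs2 !inE; lia.
- by move=> p; rewrite !inE; lia.
- by move=> p q; rewrite !inE -!orbA => /or4P[] /eqP-> /or4P[] /eqP->;
    rewrite ?eqxx // mulrC.
Qed.

Theorem theorem1p3 (k : int) (k_gt0 : 0 < k) (n : nat) (n_ge2 : (2 <= n)%N) :
  exists a b c d : nat,
    [/\ [/\ a%:Q = 16 * k%:Q ^+ 2 - 1,
            b%:Q = ((u k n)%:Q - 4 * k%:Q ^+ 2 - k%:Q) / (2 * k%:Q),
            c%:Q = ((u k n)%:Q + 4 * k%:Q ^+ 2 - k%:Q) / (2 * k%:Q)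
          & d%:Q = (u k n)%:Q ^+ 2 / k%:Q ^+ 2 - 1],
        [/\ (0 < a)%N, (0 < b)%N, (0 < c)%N & (0 < d)%N],
        uniq [:: triangular a; triangular b; triangular c; triangular d],
        all (fun t => 0 < t)%N
            [:: triangular a; triangular b; triangular c; triangular d]
      & is_Dquadruple (u k n ^+ 2)
          [fset triangular a; triangular b; triangular c; triangular d]%fset].
Proof.
have [t [s [un _ pell]]] := u_pell k n.
have := u_gt k_gt0 n_ge2; rewrite un ltr_pM2l // => t_gt.
have k2 : k <= k ^+ 2 by nia.
have [a aE] : exists a : nat, a%:Z = 16 * k ^+ 2 - 1.
  by exists (absz (16 * k ^+ 2 - 1)%R); lia.
have [b bE] : exists b : nat, b%:Z = t - 2 * k by exists (absz (t - 2 * k)%R); lia.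
have [c cE] : exists c : nat, c%:Z = t + 2 * k by exists (absz (t + 2 * k)%R); lia.
have [d dE] : exists d : nat, d%:Z = (2 * t + 1) ^+ 2 - 1.
  by exists (absz ((2 * t + 1) ^+ 2 - 1)%R); nia.
have a_gt0 : (0 < a)%N by lia.
have ab : (a < b)%N by lia.
have bc : (b < c)%N by lia.
have cd : (c < d)%N by nia.
have Ta_gt0 := triangular_lt a_gt0.
have Tab := triangular_lt ab; have Tbc := triangular_lt bc.
have Tcd := triangular_lt cd.
have Da := triangular_double a; have Db := triangular_double b.
have Dc := triangular_double c; have Dd := triangular_double d.
rewrite aE in Da; rewrite bE in Db; rewrite cE in Dc; rewrite dE in Dd.
have k_neq0 : k%:Q != 0 by rewrite intr_eq0 gt_eqF.
exists a, b, c, d; split.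
- by rewrite aE bE cE dE !(rmorphB, rmorphD, rmorphM, rmorphXn) /=;
    split; field.
- by split; lia.
- by rewrite /= !inE; lia.
- by rewrite /=; lia.
have cancel4 (x y : int) : 4 * x = 4 * y -> x = y by lia.
(* The identities for the triangular numbers give only their doubles, so each product is checked
   after scaling by 4. *)
have four (x y N r : int) :
    (2 * x) * (2 * y) + 4 * N = 4 * r ^+ 2 -> x * y + N = r ^+ 2.
  by move=> e; apply: cancel4; rewrite -e; ring.
apply: Dquadruple_of_sorted => //; first by rewrite expf_neq0 //; nia.
- exists (k * (4 * k * (2 * t + 1) - (16 * k ^+ 2 - 1))).
  by apply: four; rewrite Da Db; ring.
- exists (k * (4 * k * (2 * t + 1) + (16 * k ^+ 2 - 1))).
  by apply: four; rewrite Da Dc; ring.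
- exists (k * (2 * t + 1) * s).
  by apply: four; rewrite Da Dd [in RHS]exprMn pell; ring.
(* The two middle numbers differ by [2 * k * (2 * t + 1)], twice the root of [N], so the root is
   their midpoint. *)
- exists ((triangular b)%:Z + 2 * k * t + k).
  apply: four.
  have -> : forall T : int, 4 * (T + 2 * k * t + k) ^+ 2
      = (2 * T + 4 * k * t + 2 * k) ^+ 2 by move=> T; ring.
  by rewrite Db Dc; ring.
(* This is [v (v^2 - 1 - 4kv) / 4], integral since [(v^2 - 1) / 4 = t^2 + t]. *)
- exists ((2 * t + 1) * (t ^+ 2 + t - k * (2 * t + 1))).
  by apply: four; rewrite Db Dd; ring.
- exists ((2 * t + 1) * (t ^+ 2 + t + k * (2 * t + 1))).
  by apply: four; rewrite Dc Dd; ring.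
Qed.
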